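(* Let $u$ be a unitary element of the Cuntz algebra $\mathcal{O}_2$ such that $\lambda_u(T)\subseteq V$, where $\lambda_u$ is the unital $*$-endomorphism of $\mathcal{O}_2$ with $\lambda_u(S_i)=uS_i$ for $i=1,2$. Then $u\in V$ if and only if $\lambda_u(\mathcal{D}_2)\subseteq\mathcal{D}_2$.
   Context: The Cuntz algebra $\mathcal{O}_2$ is the $C^*$-algebra generated by two isometries $S_1,S_2$ with $S_1S_1^*+S_2S_2^*=1$. For every unitary $u\in\mathcal{O}_2$ there is a unique unital $*$-endomorphism $\lambda_u$ of $\mathcal{O}_2$ with $\lambda_u(S_i)=uS_i$, $i=1,2$. $W_2$ is the set of all finite words (multi-indices, including the empty word $\emptyset$) in the alphabet $\{1,2\}$. For $\mu=\mu_1\ldots\mu_k\in W_2$ put $S_\mu=S_{\mu_1}\cdots S_{\mu_k}$, $S_\emptyset=1$, and $P_\mu=S_\mu S_\mu^*$. The diagonal $\mathcal{D}_2$ is the $C^*$-subalgebra of $\mathcal{O}_2$ generated by all $P_\mu$, $\mu\in W_2$. The Thompson groups are realized inside the unitary group of $\mathcal{O}_2$. $V$ is the group of all unitaries of $\mathcal{O}_2$ of the form $u=\sum_{(\alpha,\beta)\in\mathcal{J}}S_\alpha S_\beta^*$ with $\mathcal{J}$ a finite collection of pairs in $W_2\times W_2$; unitarity means that, with $\mathcal{J}_1=\{\alpha:(\alpha,\beta)\in\mathcal{J}\}$ and $\mathcal{J}_2=\{\beta:(\alpha,\beta)\in\mathcal{J}\}$, one has $\sum_{\alpha\in\mathcal{J}_1}P_\alpha=1=\sum_{\beta\in\mathcal{J}_2}P_\beta$.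 $T$ is the subgroup of those $u\in V$ for which the association $\mathcal{J}_1\ni\alpha\mapsto\beta\in\mathcal{J}_2$ (with $(\alpha,\beta)\in\mathcal{J}$) respects the lexicographic order on $W_2$ up to a cyclic permutation. *)

(* Defs.v *)
From HB Require Import structures.
From mathcomp Require Import all_boot all_order all_algebra finmap.
From mathcomp Require Import all_classical all_reals all_analysis.
From mathcomp Require Import complex.

Set Implicit Arguments.
Unset Strict Implicit.
Unset Printing Implicit Defensive.

Import Order.TTheory GRing.Theory Num.Theory.
Import numFieldNormedType.Exports.

Local Open Scope classical_set_scope.
Local Open Scope ring_scope.
Local Open Scope complex_scope.

(* Unital C*-algebras over R[i], with [cone_neq0] excluding the zero algebra.
   The product is a field of the structure, and the algebra structure is
   derived from it below: a structure joining [GRing.Algebra] and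
   [NormedModule] is rejected by Hierarchy Builder, [Num.NumDomain] being
   already declared without it. *)
HB.mixin Record isCStarAlgebra (R : realType) A
    of CompleteNormedModule R[i] A := {
  cmul : A -> A -> A ;
  cone : A ;
  star : A -> A ;
  cmulA : associative cmul ;
  cmul1l : left_id cone cmul ;
  cmul1r : right_id cone cmul ;
  cmulDl : left_distributive cmul +%R ;
  cmulDr : right_distributive cmul +%R ;
  cone_neq0 : cone != 0 ;
  cscaleAl : forall (c : R[i]) (x y : A), c *: cmul x y = cmul (c *: x) y ;
  cscaleAr : forall (c : R[i]) (x y : A), c *: cmul x y = cmul x (c *: y) ;
  starK : involutive star ;
  starD : {morph star : x y / x + y} ;
  starZ : forall (c : R[i]) (x : A), star (c *: x) = c^* *: star x ;
  star_cmul : forall x y : A, star (cmul x y) = cmul (star y) (star x) ;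
  norm_cmul_le : forall x y : A, `|cmul x y| <= `|x| * `|y| ;
  norm_star_cmul : forall x : A, `|cmul (star x) x| = `|x| ^+ 2
}.

#[short(type="cstarAlgType")]
HB.structure Definition CStarAlgebra (R : realType) :=
  { A of isCStarAlgebra R A & CompleteNormedModule R[i] A }.

#[non_forgetful_inheritance]
HB.instance Definition _ (R : realType) (A : cstarAlgType R) :=
  GRing.Zmodule_isNzRing.Build A
    (@cmulA R A) (@cmul1l R A) (@cmul1r R A)
    (@cmulDl R A) (@cmulDr R A) (@cone_neq0 R A).

#[non_forgetful_inheritance]
HB.instance Definition _ (R : realType) (A : cstarAlgType R) :=
  GRing.Lmodule_isLalgebra.Build R[i] A (@cscaleAl R A).

#[non_forgetful_inheritance]
HB.instance Definition _ (R : realType) (A : cstarAlgType R) :=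
  GRing.Lalgebra_isAlgebra.Build R[i] A (@cscaleAr R A).

(* The letters 1, 2 are the elements 0, 1 of ['I_2]. *)
Definition word : Type := seq 'I_2.

Definition lexi_le (s t : word) : bool :=
  ((s : seqlexi 'I_2) <= t)%O.

Section CStar.
Context (R : realType) (A : cstarAlgType R).
Implicit Types (G B : set A) (u x y : A).

Lemma starM x y : star (x * y) = star y * star x.
Proof. exact: star_cmul. Qed.

Lemma norm_mul_le x y : `|x * y| <= `|x| * `|y|.
Proof. exact: norm_cmul_le. Qed.

Lemma norm_star_mul x : `|star x * x| = `|x| ^+ 2.
Proof. exact: norm_star_cmul. Qed.

Definition isometry_elt x : Prop := star x * x = 1.

Definition unitary_elt u : Prop := star u * u = 1 /\ u * star u = 1.

Definition cstar_subalgebra B : Prop :=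
  [/\ B 0,
      (forall (c : R[i]) x y, B x -> B y -> B (c *: x + y)),
      (forall x y, B x -> B y -> B (x * y)),
      (forall x, B x -> B (star x)) &
      closed B].

Definition cstar_generated G : set A := smallest cstar_subalgebra G.

End CStar.

Section Cuntz.
Context (R : realType) (A : cstarAlgType R) (S : 'I_2 -> A).

(* [A] with the pair [S] is the Cuntz algebra O_2. *)
Definition cuntz_algebra : Prop :=
  [/\ (forall i, isometry_elt (S i)),
      \sum_i S i * star (S i) = 1 &
      cstar_generated (range S) = setT].

Definition wordS (mu : word) : A := \prod_(i <- mu) S i.

Definition wordP (mu : word) : A := wordS mu * star (wordS mu).

Definition cuntz_diagonal : set A := cstar_generated (range wordP).

Definition table_elt (J : {fset word * word}) : A :=
  \sum_(p <- J) wordS p.1 * star (wordS p.2).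

(* The last two conditions follow from the first two; they are kept because
   they are what unitarity of [table_elt J] amounts to combinatorially. *)
Definition tableV (J : {fset word * word}) (u : A) : Prop :=
  [/\ unitary_elt u,
      u = table_elt J,
      \sum_(a <- [fset p.1 | p in J]%fset) wordP a = 1 &
      \sum_(b <- [fset p.2 | p in J]%fset) wordP b = 1].

Definition thompsonV : set A := [set u | exists J, tableV J u].

(* Listing the pairs of [J] by increasing first component, the second
   components are increasing up to a rotation. *)
Definition lexi_cyclic (J : {fset word * word}) : Prop :=
  exists k : nat,
    sorted lexi_le
      (rot k [seq p.2 | p <- sort (fun p q => lexi_le p.1 q.1) J]).

Definition thompsonT : set A :=
  [set u | exists2 J, tableV J u & lexi_cyclic J].

(* [lam] is the endomorphism lambda_u of O_2. *)
Definition cuntz_endo (u : A) (lam : {lrmorphism A -> A}) : Prop :=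
  (forall x, lam (star x) = star (lam x)) /\ (forall i, lam (S i) = u * S i).

End Cuntz.

(* Main.v *)
Require Import Defs.
From mathcomp Require Import all_boot all_order all_algebra finmap.
From mathcomp Require Import all_classical all_reals all_analysis.
From mathcomp Require Import complex.

(** Write [S_w] for the product of isometries along a word [w] and
    [P_w = S_w S_w^*]. The argument works with the set of finite sums of
    monomials [S_a S_b^*], which is closed under sums and products.

    The bridge between this set and Thompson's group is a normal form
    ([unitary_normal_form]): if a unitary [u] is a finite sum of monomials, then
    for [n] large every [u S_w] with [|w| = n] is a sum of some [S_v], and a sum
    of [S_v] that is an isometry has a single term ([isometric_word_sum]). So [u]
    maps each [S_w], [|w| = n], to one [S_(g w)]: it is given by the table
    [g w -> w], hence lies in [V].

    If [u] is in [V], the normal form shows that conjugation by [u] sends each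
    [P_w] to a finite sum of projections of the same kind. Since
    [lam P_(iw) = (u S_i) (lam P_w) (u S_i)^*], induction on [w] puts every
    [lam P_w] in the diagonal, and the continuity of [lam] extends this to the
    closed algebra that the [P_w] generate. Continuity holds because a
    self-adjoint [h] of small norm is the average of the unitaries [h +/- i k]
    with [k^2 = 1 - h^2], whose images have norm 1 ([morphism_norm_le]).

    Conversely, suppose that [lam] preserves the diagonal. The monomial
    [S_i S_j S_j^*] is [v P_j] for some [v] in [T] ([thompsonT_cut]), so its
    image is [lam v * lam P_j]. The first factor is in [V], the second is a
    projection of the diagonal, hence a finite sum of [P_w]
    ([diagonal_projection]). Both are finite sums of monomials, and so is
      [u = \sum_(i, j) lam (S_i S_j S_j^* ) S_i^*],
    which the normal form places in [V]. *)

Set Implicit Arguments.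
Unset Strict Implicit.
Unset Printing Implicit Defensive.

Import Order.TTheory GRing.Theory Num.Theory.
Import numFieldNormedType.Exports.

Local Open Scope classical_set_scope.
Local Open Scope ring_scope.

(** * Approximation in normed modules *)

Section Approx.
Context {K : numFieldType} {V : normedModType K}.

Lemma closed_normP (B : set V) :
  closed B <-> forall x, (forall e : K, 0 < e ->
    exists2 y, B y & `|x - y| < e) -> B x.
Proof.
split=> [cB x xB|xB x clx].
- apply: cB => U /nbhs_ballP[e /= e0 eU].
  have [y By xy] := xB _ e0; exists y; split=> //.
  by apply: eU; rewrite -ball_normE.
- apply: xB => e e0; have [y [By]] := clx _ (nbhsx_ballx x e e0).
  by rewrite -ball_normE; exists y.
Qed.

Lemma norm_small_eq0 (c : K) (x : V) : 0 <= c ->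
  (forall e : K, 0 < e -> `|x| <= c * e) -> x = 0.
Proof.
move=> c0 xc; apply/eqP; rewrite -normr_eq0; apply/negP => /negP x0.
have xp : 0 < `|x| by rewrite lt_def x0 normr_ge0.
have c1 : 0 < c + 1 by rewrite ltr_wpDl.
have c2 : 0 < 2 * (c + 1) by rewrite mulr_gt0.
have := xc (`|x| / (2 * (c + 1))) (divr_gt0 xp c2).
rewrite mulrCA -[leLHS]mulr1 ler_pM2l// ler_pdivlMr// mul1r.
apply/negP; rewrite -real_ltNge ?ger0_real ?(ltW c2)//.
by rewrite mulrDr mulr1 mulr_natl mulr2n -addrA ltrDl ltr_wpDl.
Qed.

End Approx.

(** * A fixed-point theorem over the complex numbers *)

Section FixedPoint.
Context {R : realType} {X : completeNormedModType R[i]}.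

Lemma half_pow_small (e : R[i]) : 0 < e -> exists n, 2^-1 ^+ n < e.
Proof.
case: e => a b; rewrite ltcE /= => /andP[/eqP b0 a0].
have [n _ /(_ n (leqnn n))] := near_infty_natSinv_expn_lt (PosNum a0).
rewrite /= div1r -exprVn => h; exists n.
have -> : (2^-1 : R[i]) ^+ n = (2^-1 ^+ n : R)%:C%C.
  by rewrite rmorphXn fmorphV rmorph_nat.
by rewrite b0 -[(a +i* 0)%C]/(a%:C)%C ltcR.
Qed.

Lemma half_pow_cvg (x : X ^nat) :
  (forall n, `|x n - x n.+1| <= 2^-1 ^+ n) ->
  exists l, forall e, 0 < e -> exists N, forall n, (N <= n)%N -> `|l - x n| < e.
Proof.
move=> step.
have dist n m : `|x n - x (n + m)%N| <= 2 * 2^-1 ^+ n - 2 * 2^-1 ^+ (n + m).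
  elim: m => [|m ih]; first by rewrite addn0 !subrr normr0.
  rewrite (le_trans (ler_distD (x (n + m)%N) _ _))//.
  rewrite addnS (le_trans (lerD ih (step _)))// exprS mulrA divff// mul1r.
  by rewrite -addrA lerD2l mulr_natl mulr2n opprD addrNK.
have cx : cvgn x.
  apply/cauchy_cvgP/cauchy_ballP => e e0; near_simpl.
  have [N hN] := half_pow_small (divr_gt0 e0 (ltr0n _ 4)).
  exists ([set n | N <= n], [set n | N <= n])%N; first by split; exists N.
  move=> [n m] [/= Nn Nm]; rewrite -ball_normE /=.
  have hk k : (N <= k)%N -> `|x N - x k| < e / 2.
    move=> Nk; have := dist N (k - N)%N; rewrite subnKC// => /le_lt_trans; apply.
    apply: (@le_lt_trans _ _ (2 * 2^-1 ^+ N)).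
      by rewrite gerBl mulr_ge0// exprn_ge0.
    have -> : e / 2 = 2 * (e / 4).
      rewrite mulrCA; congr (_ * _).
      by rewrite -[4]/(2 * 2)%:R natrM invfM mulrA divff// mul1r.
    by rewrite ltr_pM2l.
  rewrite (le_lt_trans (ler_distD (x N) _ _))// (splitr e) ltrD//.
    by rewrite distrC hk.
  exact: hk.
exists (limn x) => e e0.
by have [N _ hN] := (@cvgrPdist_lt _ _ _ _ _ x (limn x)).1 cx e e0; exists N.
Qed.

(** Banach's principle for norms with values in [R[i]], with the ratio 1/2 that
    the square root in [self_adjoint_sqrt] calls for. *)
Lemma half_contraction_fixed_point (U : set X) (F : X -> X) (x0 : X) :
  closed U -> U x0 -> (forall x, U x -> U (F x)) ->
  (forall x y, U x -> U y -> `|F x - F y| <= 2^-1 * `|x - y|) ->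
  exists2 p, U p & F p = p.
Proof.
move=> cU Ux FU FC.
have [M hM] : exists M : R[i], 0 < M /\ `|x0 - F x0| <= M.
  by exists (`|x0 - F x0| + 1); rewrite ltr_wpDl// lerDl.
have [M0 M1] := hM.
(* Rescaling makes the first step of the iteration have norm at most 1. *)
pose x n := M^-1 *: iter n F x0.
have Ui n : U (iter n F x0) by elim: n => //= n; exact: FU.
have step n : `|x n - x n.+1| <= 2^-1 ^+ n.
  rewrite -scalerBr normrZ normfV gtr0_norm// ler_pdivrMl//.
  elim: n => [|n ih]; first by rewrite mulr1.
  apply: (le_trans (FC _ _ (Ui n) (Ui n.+1))); rewrite exprS mulrCA.
  by rewrite ler_pM2l ?invr_gt0.
have [l hl] := half_pow_cvg step.
have {}hl e : 0 < e -> exists n,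
    `|M *: l - iter n F x0| < e /\ `|M *: l - iter n.+1 F x0| < e.
  move=> e0; have [N hN] := hl _ (divr_gt0 e0 M0).
  have hk n : (N <= n)%N -> `|M *: l - iter n F x0| < e.
    move=> Nn; have := hN n Nn; rewrite ltr_pdivlMr// mulrC.
    rewrite -{1}(gtr0_norm M0) -normrZ scalerBr scalerA divff ?scale1r//.
    by rewrite gt_eqF.
  by exists N; split; apply: hk.
have Ul : U (M *: l).
  by apply: (closed_normP U).1 => // e /hl[n [hn _]]; exists (iter n F x0).
exists (M *: l) => //; apply/subr0_eq/(@norm_small_eq0 _ _ 2) => // e /hl[n [hn hn1]].
rewrite (le_trans (ler_distD (iter n.+1 F x0) _ _))// mulr_natl mulr2n.
rewrite lerD//; last by rewrite distrC ltW.
apply: (le_trans (FC _ _ Ul (Ui n))); apply: (le_trans _ (ltW hn)).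
by rewrite ler_piMl// invf_le1 ?ler1n.
Qed.

End FixedPoint.

(** * Norms and square roots in a C*-algebra *)

Section CStar.
Context {R : realType} {A : cstarAlgType R}.
Implicit Types x y h b p : A.

Lemma norm_projection p : star p = p -> p * p = p -> p != 0 -> `|p| = 1.
Proof.
move=> sp pp p0; have := norm_star_mul p; rewrite sp pp expr2.
by rewrite -[LHS]mulr1 => /mulfI; rewrite normr_eq0 => /(_ p0)/esym.
Qed.

Lemma star1 : star (1 : A) = 1.
Proof. by rewrite -[LHS]mulr1 -{2}(starK 1) -starM mulr1 starK. Qed.

Lemma norm_one : `|1 : A| = 1.
Proof. by apply: norm_projection; rewrite ?star1 ?mulr1 ?oner_neq0. Qed.

Lemma norm_star x : `|star x| = `|x|.
Proof.
have le y : `|y| <= `|star y|.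
  have [->|y0] := eqVneq y 0; first by rewrite normr0.
  have yp : 0 < `|y| by rewrite normr_gt0.
  by rewrite -(ler_pM2r yp) -expr2 -norm_star_mul norm_mul_le.
by apply/le_anti; rewrite le andbT -{2}(starK x) le.
Qed.

Lemma norm_isometry x : star x * x = 1 -> `|x| = 1.
Proof.
move=> xx; have := norm_star_mul x; rewrite xx norm_one => /esym/eqP.
by rewrite sqrp_eq1// => /eqP.
Qed.

Lemma star0 : star (0 : A) = 0.
Proof. by apply: (@addrI _ (star 0)); rewrite -starD !addr0. Qed.

Lemma starN x : star (- x) = - star x.
Proof. by apply: (@addrI _ (star x)); rewrite -starD !subrr star0. Qed.

Lemma starB x y : star (x - y) = star x - star y.
Proof. by rewrite starD starN. Qed.

Lemma star_sum (I : Type) (r : seq I) (P : pred I) (F : I -> A) :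
  star (\sum_(i <- r | P i) F i) = \sum_(i <- r | P i) star (F i).
Proof. exact: (big_morph _ (@starD _ _) star0). Qed.

Lemma half_plus_half : 2^-1 + 2^-1 = 1 :> R[i].
Proof. by rewrite [RHS]splitr !mul1r. Qed.

(** The square root of [1 - h^2] is [k = 1 - b], where [b] solves
    [b = (h^2 + b^2) / 2]. On the ball of radius 1/2 the right-hand side is a
    contraction of ratio 1/2, and it preserves the closed set of self-adjoint
    elements that commute with [h]. *)
Lemma self_adjoint_sqrt h : star h = h -> `|h| <= 2^-1 ->
  exists k, [/\ star k = k, k * h = h * k & h * h + k * k = 1].
Proof.
move=> sh h2.
pose U := [set b : A | [/\ star b = b, b * h = h * b & `|b| <= 2^-1]].
pose F (b : A) : A := (2^-1 : R[i]) *: (h * h + b * b).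
have cU : closed U.
  apply/closed_normP => b bU; split.
  - apply/subr0_eq/(@norm_small_eq0 _ _ 2) => // e /bU[c [sc _ _] bc].
    have -> : star b - b = star (b - c) - (b - c).
      by rewrite starB sc opprB addrA addrNK.
    rewrite (le_trans (ler_normB _ _))// norm_star.
    by rewrite mulr_natl mulr2n lerD// ltW.
  - apply/subr0_eq/(@norm_small_eq0 _ _ (`|h| + `|h|))
      => [|e /bU[c [_ ch _] bc]]; first exact: addr_ge0.
    have -> : b * h - h * b = (b - c) * h - h * (b - c).
      by rewrite mulrBl mulrBr ch opprB addrA addrNK.
    rewrite (le_trans (ler_normB _ _))//.
    rewrite (le_trans (lerD (norm_mul_le _ _) (norm_mul_le _ _)))//.
    by rewrite [_ * `|h|]mulrC -mulrDl ler_wpM2l ?addr_ge0// ltW.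
  - apply/ler_addgt0Pr => e /bU[c [_ _ c2] bc].
    rewrite -(subrK c b) addrC (le_trans (ler_normD _ _))// lerD// ltW//.
have FU b : U b -> U (F b).
  case=> sb bh b2; split.
  - have half_ge0 : 0 <= (2^-1 : R[i]) by [].
    by rewrite starZ (geC0_conj half_ge0) starD !starM sb sh.
  - by rewrite -scalerAl -scalerAr mulrDl mulrDr !mulrA -[b * b * h]mulrA bh !mulrA bh.
  - rewrite normrZ normfV normr_nat ler_piMr// (le_trans (ler_normD _ _))//.
    rewrite (le_trans (lerD (norm_mul_le _ _) (norm_mul_le _ _)))//.
    have sq (r : R[i]) : 0 <= r -> r <= 2^-1 -> r * r <= 2^-1 * 2^-1.
      by move=> r0 r2; rewrite ler_pM.
    rewrite (le_trans (lerD (sq _ _ _) (sq _ _ _)))// -mulrDl half_plus_half mul1r.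
    by rewrite invf_le1 ?ler1n.
have FC x y : U x -> U y -> `|F x - F y| <= 2^-1 * `|x - y|.
  move=> [_ _ x2] [_ _ y2]; rewrite -scalerBr normrZ normfV normr_nat.
  rewrite ler_pM2l ?invr_gt0// opprD addrACA subrr add0r.
  have -> : x * x - y * y = x * (x - y) + (x - y) * y.
    by rewrite mulrBl mulrBr addrA addrNK.
  rewrite (le_trans (ler_normD _ _))//.
  rewrite (le_trans (lerD (norm_mul_le _ _) (norm_mul_le _ _)))//.
  rewrite [_ * `|y|]mulrC -mulrDl ler_piMl//.
  by rewrite (le_trans (lerD x2 y2))// half_plus_half.
have U0 : U 0 by split; rewrite ?star0 ?mul0r ?mulr0 ?normr0.
have [b [sb bh _] Fb] := half_contraction_fixed_point cU U0 FU FC.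
exists (1 - b); split; first by rewrite starB star1 sb.
  by rewrite mulrBl mulrBr mul1r mulr1 bh.
have : h * h + b * b = b + b.
  by rewrite -{3 4}Fb /F -scalerDl half_plus_half scale1r.
move=> bb; rewrite mulrBl !mulrBr !mul1r mulr1 opprB.
by rewrite addrACA [LHS]addrA [h * h + (1 + _)]addrCA bb -opprD addrK.
Qed.

(** * Closures of *-subalgebras *)

Definition star_subalgebra B : Prop :=
  [/\ B 0, forall (c : R[i]) x y, B x -> B y -> B (c *: x + y),
      forall x y, B x -> B y -> B (x * y) & forall x, B x -> B (star x)].

(** The norm closure of [B]. *)
Definition approximable B : set A :=
  [set x | forall e : R[i], 0 < e -> exists2 y, B y & `|x - y| < e].

Lemma sub_approximable B : B `<=` approximable B.
Proof. by move=> x Bx e e0; exists x; rewrite // subrr normr0. Qed.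

Lemma approximable_cstar B : star_subalgebra B -> cstar_subalgebra (approximable B).
Proof.
move=> [B0 BL BM BS]; split.
- exact: sub_approximable.
- move=> c x y hx hy e e0.
  have c0 : 0 < `|c| + 1 by rewrite ltr_wpDl.
  have e2 : 0 < e / 2 by rewrite divr_gt0.
  have [x' Bx xx] := hx _ (divr_gt0 e2 c0).
  have [y' By yy] := hy _ e2.
  exists (c *: x' + y'); first exact: BL.
  rewrite opprD addrACA -scalerBr (le_lt_trans (ler_normD _ _))// (splitr e).
  rewrite ler_ltD// normrZ (le_trans (ler_wpM2l _ (ltW xx)))// mulrCA.
  by rewrite ler_piMr ?(ltW e2)// ler_pdivrMr// mul1r lerDl.
- move=> x y hx hy e e0.
  have e2 : 0 < e / 2 by rewrite divr_gt0.
  have x0 : 0 < `|x| + 1 by rewrite ltr_wpDl.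
  have [y' By yy] := hy _ (divr_gt0 e2 x0).
  have y0 : 0 < `|y'| + 1 by rewrite ltr_wpDl.
  have [x' Bx xx] := hx _ (divr_gt0 e2 y0).
  exists (x' * y'); first exact: BM.
  have -> : x * y - x' * y' = x * (y - y') + (x - x') * y'.
    by rewrite mulrBr mulrBl addrA addrNK.
  rewrite (le_lt_trans (ler_normD _ _))// (splitr e).
  have small (a b k : R[i]) : 0 <= a -> b < k / (a + 1) -> 0 <= b -> 0 < k -> a * b < k.
    move=> a0 bk b0 k0; have a1 : 0 < a + 1 by rewrite ltr_wpDl.
    rewrite (@le_lt_trans _ _ ((a + 1) * b))//; first by rewrite ler_wpM2r// lerDl.
    by rewrite mulrC -ltr_pdivlMr.
  rewrite ltrD// (le_lt_trans (norm_mul_le _ _))//.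
    exact: small.
  by rewrite mulrC; exact: small.
- move=> x hx e /hx[y By xy]; exists (star y); first exact: BS.
  by rewrite -starB norm_star.
- apply/closed_normP => x hx e e0.
  have e2 : 0 < e / 2 by rewrite divr_gt0.
  have [y hy xy] := hx _ e2; have [z Bz yz] := hy _ e2; exists z => //.
  by rewrite (le_lt_trans (ler_distD y _ _))// (splitr e) ltrD.
Qed.

(** If both [p] and [1 - p] are non-zero they have norm 1; multiplying [p - c] by
    [p] and by [1 - p] then gives [|1 - c| < 1/2] and [|c| < 1/2]. *)
Lemma projection_near_scalar p (c : R[i]) : star p = p -> p * p = p ->
  `|p - c *: 1| < 2^-1 -> p = 0 \/ p = 1.
Proof.
move=> sp pp pc; have [->|p0] := eqVneq p 0; first by left.
have [->|p1] := eqVneq p 1; first by right.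
have np : `|p| = 1 by apply: norm_projection.
have nq : `|1 - p| = 1.
  apply: norm_projection; rewrite ?starB ?star1 ?sp//.
    by rewrite mulrBl mul1r mulrBr mulr1 pp subrr subr0.
  by rewrite subr_eq0 eq_sym.
have c1 : `|1 - c| < 2^-1.
  have <- : `|(1 - c) *: p| = `|1 - c| by rewrite normrZ np mulr1.
  rewrite (le_lt_trans _ pc)//.
  have -> : (1 - c) *: p = p * (p - c *: 1).
    by rewrite mulrBr pp -scalerAr mulr1 scalerBl scale1r.
  by rewrite (le_trans (norm_mul_le _ _))// np mul1r.
have c0 : `|c| < 2^-1.
  have <- : `|- (c *: (1 - p))| = `|c| by rewrite normrN normrZ nq mulr1.
  rewrite (le_lt_trans _ pc)//.
  have -> : - (c *: (1 - p)) = (1 - p) * (p - c *: 1).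
    by rewrite mulrBr -scalerAr mulr1 mulrBl pp mul1r subrr add0r.
  by rewrite (le_trans (norm_mul_le _ _))// nq mul1r.
have := ltrD c1 c0; rewrite half_plus_half => /(le_lt_trans (ler_normD _ _)).
by rewrite subrK normr1 ltxx.
Qed.

(** * Continuity of *-endomorphisms *)

Section Bounded.
Variable lam : {lrmorphism A -> A}.
Hypothesis lam_star : forall x, lam (star x) = star (lam x).

(** A self-adjoint [h] of norm at most 1/2 is the average of the unitaries
    [h + i k] and [h - i k] with [k^2 = 1 - h^2]; a *-morphism maps them to
    unitaries, so [|lam h| <= 1]. Scaling and the identity [|x|^2 = |x^* x|]
    give the general bound; its constant is not optimal, but it is all that
    continuity requires. *)
Lemma morphism_norm_le x : `|lam x| <= 2 * `|x|.
Proof.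
have small h : star h = h -> `|h| <= 2^-1 -> `|lam h| <= 1.
  move=> sh h2; have [k [sk kh hk]] := self_adjoint_sqrt sh h2.
  have un (e : R[i]) : e * e = -1 -> e^* = - e ->
      `|lam (h + e *: k)| = 1.
    move=> ee ec; apply: norm_isometry.
    rewrite -lam_star -rmorphM starD starZ sh sk ec scaleNr.
    rewrite mulrBl !mulrDr -!scalerAl -!scalerAr kh.
    rewrite scalerA ee scaleN1r opprD opprK addrA addrK.
    by rewrite hk rmorph1.
  have -> : lam h =
      (2^-1 : R[i]) *: (lam (h + 'i *: k) + lam (h + (- 'i) *: k)).
    rewrite -[h + - 'i *: k]/(h + (- 'i) *: k) scaleNr !raddfD raddfN /=.
    by rewrite addrACA ?scalerN subrr addr0 -scalerDl half_plus_half scale1r.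
  rewrite normrZ normfV normr_nat ler_pdivrMl// mulr1 (le_trans (ler_normD _ _))//.
  have ii : 'i * 'i = -1 :> R[i] by rewrite -expr2 sqrCi.
  by rewrite (un _ ii (conjCi _)) un// ?mulrNN// rmorphN /= conjCi.
have sa h : star h = h -> `|lam h| <= 2 * `|h|.
  move=> sh; have [->|h0] := eqVneq h 0; first by rewrite raddf0 normr0 mulr0.
  have hp : 0 < 2 * `|h| by rewrite mulr_gt0 ?normr_gt0.
  have hV : 0 <= (2 * `|h|)^-1 by rewrite invr_ge0 ltW.
  have := small ((2 * `|h|)^-1 *: h).
  rewrite starZ (geC0_conj hV) sh => /(_ erefl).
  rewrite linearZ !normrZ ger0_norm// invfM -mulrA mulVf ?normr_eq0// mulr1.
  move=> /(_ (lexx _)).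
  by rewrite -invfM ler_pdivrMl// mulr1.
have l2 : `|lam x| ^+ 2 <= (2 * `|x|) ^+ 2.
  rewrite -norm_star_mul -lam_star -rmorphM.
  have /sa : star (star x * x) = star x * x by rewrite starM starK.
  move=> /le_trans; apply; rewrite norm_star_mul exprMn.
  by rewrite ler_wpM2r ?exprn_ge0// -natrX ler_nat.
by move: l2; rewrite ler_sqr ?nnegrE ?mulr_ge0.
Qed.

Lemma preimage_cstar_subalgebra (B : set A) :
  cstar_subalgebra B -> cstar_subalgebra (lam @^-1` B).
Proof.
move=> [B0 BL BM BS cB]; split => /=.
- by rewrite raddf0.
- by move=> c x y Bx By; rewrite linearP; exact: BL.
- by move=> x y Bx By; rewrite rmorphM; exact: BM.
- by move=> x Bx; rewrite lam_star; exact: BS.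
- apply/closed_normP => x hx; apply: (closed_normP B).1 => // e e0.
  have [y By xy] := hx _ (divr_gt0 e0 (ltr0Sn _ 1)).
  exists (lam y) => //; rewrite -raddfB (le_lt_trans (morphism_norm_le _))//.
  by rewrite mulrC -ltr_pdivlMr.
Qed.

End Bounded.

End CStar.

(** * Words in the isometries *)

Section Cuntz.
Context {R : realType} {A : cstarAlgType R} (S : 'I_2 -> A).
Hypothesis S_isometry : forall i, isometry_elt (S i).
Hypothesis S_total : \sum_i S i * star (S i) = 1.
Local Notation Sw := (wordS S).
Local Notation Pw := (wordP S).
Implicit Types (a b c d w : word) (x y : A).

Lemma wordS0 : Sw [::] = 1.
Proof. exact: big_nil. Qed.

Lemma wordS_cons i w : Sw (i :: w) = S i * Sw w.
Proof. exact: big_cons. Qed.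

Lemma wordS_cat a b : Sw (a ++ b) = Sw a * Sw b.
Proof. exact: big_cat. Qed.

(** Orthogonality of the two ranges: multiply [S_1 S_1^* + S_2 S_2^* = 1] by
    [S_i^*] on the left and by [S_j] on the right. *)
Lemma star_S_S i j : star (S i) * S j = (i == j)%:R.
Proof.
have [<-|ij] := eqVneq i j; first exact: S_isometry.
have S2 : S i * star (S i) + S j * star (S j) = 1.
  rewrite -S_total (bigD1 i)//= (bigD1 j) 1?eq_sym//= big1 ?addr0// => k /andP[ki kj].
  case/eqP: ij; apply/val_inj => /=.
  by case: i j k ki kj => [[|[|?]] ?] [[|[|?]] ?] [[|[|?]] ?].
have := congr1 (fun x => star (S i) * x * S j) S2.
rewrite mulrDr mulrDl mulr1 !mulrA S_isometry mul1r.
rewrite -[_ * star (S j) * S j]mulrA S_isometry mulr1.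
by move=> /(canRL (addrK _)); rewrite subrr.
Qed.

Lemma star_wordS_wordS w : star (Sw w) * Sw w = 1.
Proof.
elim: w => [|i w ih]; first by rewrite wordS0 star1 mulr1.
by rewrite wordS_cons starM -mulrA [star (S i) * _]mulrA S_isometry mul1r.
Qed.

Lemma star_wordS_cat a b : star (Sw a) * Sw (a ++ b) = Sw b.
Proof. by rewrite wordS_cat mulrA star_wordS_wordS mul1r. Qed.

Lemma star_wordS_catl a b : star (Sw (a ++ b)) * Sw a = star (Sw b).
Proof. by rewrite -[LHS]starK starM starK star_wordS_cat. Qed.

Lemma star_wordS_incomparable a b :
  ~~ prefix a b -> ~~ prefix b a -> star (Sw a) * Sw b = 0.
Proof.
elim: a b => [|i a ih] [|j b]//=.
rewrite !wordS_cons starM -mulrA [star (S i) * _]mulrA star_S_S.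
have [_|_] := eqVneq i j; last by rewrite mul0r mulr0.
by rewrite mul1r => /ih.
Qed.

Lemma star_wordS_same_size a b :
  size a = size b -> star (Sw a) * Sw b = (a == b)%:R.
Proof.
have [<- _|ab sab] := eqVneq a b; first exact: star_wordS_wordS.
have pre c d : size c = size d -> prefix c d -> c = d.
  move=> scd /prefixP[v e]; rewrite e.
  have /size0nil -> : size v = 0%N; last by rewrite cats0.
  by apply/eqP; rewrite -(eqn_add2l (size c)) addn0 -size_cat -e scd.
apply: star_wordS_incomparable; apply: contraNN ab => /pre -> //.
Qed.

Lemma star_wordP w : star (Pw w) = Pw w.
Proof. by rewrite /wordP starM starK. Qed.

Lemma wordP_wordS w : Pw w * Sw w = Sw w.
Proof. by rewrite /wordP -mulrA star_wordS_wordS mulr1. Qed.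

Lemma wordP_catl a b : Pw a * Pw (a ++ b) = Pw (a ++ b).
Proof. by rewrite {2}/wordP mulrA wordS_cat [Pw a * _]mulrA wordP_wordS -wordS_cat. Qed.

Lemma wordP_comm a b : Pw a * Pw b = Pw b * Pw a.
Proof.
suff le c d : prefix c d -> Pw c * Pw d = Pw d * Pw c.
  have [/le//|ab] := boolP (prefix a b).
  have [/le//|ba] := boolP (prefix b a).
  rewrite /wordP mulrA -[_ * star _ * _]mulrA star_wordS_incomparable//.
  rewrite mulr0 mul0r !mulrA -[_ * star _ * _]mulrA.
  by rewrite star_wordS_incomparable// mulr0 mul0r.
move=> /prefixP[v ->]; rewrite wordP_catl.
by rewrite -[RHS]starK starM !star_wordP wordP_catl star_wordP.
Qed.

Fixpoint words (n : nat) : seq word :=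
  if n is n'.+1 then [seq i :: w | i <- enum 'I_2, w <- words n'] else [:: [::]].

Lemma mem_words n w : (w \in words n) = (size w == n).
Proof.
elim: n w => [|n ih] w /=; first by rewrite inE size_eq0.
apply/allpairsP/idP => [[[i v] /= [_ vn ->]]|].
  by rewrite /= eqSS -ih.
case: w => // i w; rewrite /= eqSS -ih => wn.
by exists (i, w); split; rewrite // mem_enum.
Qed.

Lemma words_uniq n : uniq (words n).
Proof.
elim: n => //= n ih; apply: allpairs_uniq => //; first exact: enum_uniq.
by move=> [i v] [j w] _ _ [-> ->].
Qed.

Lemma sum_wordP n : \sum_(w <- words n) Pw w = 1.
Proof.
elim: n => [|n ih]; first by rewrite big_seq1 /wordP wordS0 star1 mulr1.
rewrite big_allpairs_dep -S_total big_enum /=; apply: eq_bigr => i _.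
transitivity (\sum_(w <- words n) S i * Pw w * star (S i)).
  by apply: eq_bigr => w _; rewrite /wordP wordS_cons starM !mulrA.
by rewrite -mulr_suml -mulr_sumr ih mulr1.
Qed.

Lemma eq_on_words n x y :
  (forall w, size w = n -> x * Sw w = y * Sw w) -> x = y.
Proof.
move=> xy; rewrite -[x]mulr1 -[y]mulr1 -(sum_wordP n) !mulr_sumr.
rewrite !big_seq; apply: eq_bigr => w; rewrite mem_words => /eqP/xy e.
by rewrite /wordP !mulrA e.
Qed.

Lemma wordP_split n w : Pw w = \sum_(v <- words n) Pw (w ++ v).
Proof.
transitivity (\sum_(v <- words n) Sw w * Pw v * star (Sw w)).
  by rewrite -mulr_suml -mulr_sumr sum_wordP mulr1.
by apply: eq_bigr => v _; rewrite /wordP wordS_cat starM !mulrA.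
Qed.

(** * Finite sums of monomials *)

Definition monomial (p : word * word) : A := Sw p.1 * star (Sw p.2).

Definition monomial_sum : set A :=
  [set x | exists s : seq (word * word), x = \sum_(p <- s) monomial p].

Lemma monomial_sum0 : monomial_sum 0.
Proof. by exists [::]; rewrite big_nil. Qed.

Lemma monomial_sum_monomial p : monomial_sum (monomial p).
Proof. by exists [:: p]; rewrite big_seq1. Qed.

Lemma monomial_sumD x y :
  monomial_sum x -> monomial_sum y -> monomial_sum (x + y).
Proof. by move=> [s ->] [t ->]; exists (s ++ t); rewrite big_cat. Qed.

Lemma monomial_sum_sum (I : Type) (r : seq I) (P : pred I) (F : I -> A) :
  (forall i, P i -> monomial_sum (F i)) ->
  monomial_sum (\sum_(i <- r | P i) F i).
Proof.
by move=> hF; apply: big_ind; [exact: monomial_sum0|exact: monomial_sumD|].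
Qed.

(** [S_b^* S_c] is a word, the adjoint of a word, or zero, according to how the
    words [b] and [c] compare for the prefix order. *)
Lemma monomial_sumM x y :
  monomial_sum x -> monomial_sum y -> monomial_sum (x * y).
Proof.
move=> [s ->] [t ->]; rewrite mulr_suml; apply: monomial_sum_sum => -[a b] _.
rewrite mulr_sumr; apply: monomial_sum_sum => -[c d] _.
rewrite /monomial /= mulrA -[_ * star _ * _]mulrA.
have [/prefixP[v ->]|bc] := boolP (prefix b c).
  by rewrite star_wordS_cat -wordS_cat; exact: (monomial_sum_monomial (_, _)).
have [/prefixP[v ->]|cb] := boolP (prefix c b).
  rewrite star_wordS_catl -mulrA -starM -wordS_cat.
  exact: (monomial_sum_monomial (_, _)).
by rewrite star_wordS_incomparable// mulr0 mul0r; exact: monomial_sum0.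
Qed.


(** * Unitaries that are finite sums of monomials *)

(** Shifted by between 1 and [n] letters this word disagrees with itself, since
    its last letter then meets one of the earlier ones. *)
Definition marker n : word := rcons (nseq n ord0) ord_max.

(** Appending the marker makes any two distinct words of length at most [n]
    incomparable, even when one is a prefix of the other. *)
Lemma star_wordS_marker n c d : (size c <= n)%N -> (size d <= n)%N ->
  star (Sw (c ++ marker n)) * Sw (d ++ marker n) = (c == d)%:R.
Proof.
have pre a b : (size a <= n)%N -> (size b <= n)%N ->
    prefix (a ++ marker n) (b ++ marker n) -> a = b.
  move=> an bn /prefixP[v e].
  have ab : (size a <= size b)%N.
    move/(congr1 size): e; rewrite !size_cat addnAC => /addIn ->.
    exact: leq_addr.
  (* The last letter of the marker of [a] falls on a letter of the marker of
     [b], which must be the last one too. *)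
  have := congr1 (fun w => nth ord0 w (size a + n)) e.
  rewrite -catA !nth_cat ltnNge (leq_trans bn (leq_addl _ _)) /=.
  rewrite ltnNge leq_addr /= addKn size_rcons size_nseq ltnSn.
  rewrite !nth_rcons size_nseq ltnn eqxx nth_nseq.
  have [_|_|eq _] := ltngtP (size a + n - size b)%N n; [by move=> /(congr1 val)..|].
  have sab : size a = size b.
    apply/eqP; rewrite -(eqn_add2r n) [(size b + n)%N]addnC -{2}eq.
    by rewrite subnK// (leq_trans bn)// leq_addl.
  have := congr1 (take (size a)) e.
  by rewrite -catA take_size_cat// take_size_cat.
move=> cn dn; have [->|cd] := eqVneq c d; first exact: star_wordS_wordS.
apply: star_wordS_incomparable => //; apply: contraNN cd => /pre -> //.
Qed.

(** Compressing [x^* x = 1] by [S_m], with [m] a long enough marker, kills the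
    products of two distinct words and turns the identity into an equation
    between integers: the number of pairs of equal entries of [l] is 1. *)
Lemma isometric_word_sum (l : seq word) x :
  x = \sum_(w <- l) Sw w -> star x * x = 1 -> exists w, x = Sw w.
Proof.
move=> xl xx; pose n := (\max_(w <- l) size w)%N.
have ln w : w \in l -> (size w <= n)%N.
  by move=> wl; apply: (@leq_bigmax_seq _ l xpredT (fun w => size w)).
pose m := (\sum_(c <- l) \sum_(d <- l) (c == d))%N.
have m1 : m%:R = 1 :> A.
  have e1 : star (x * Sw (marker n)) * (x * Sw (marker n)) = 1.
    rewrite starM mulrA -[_ * star x * x]mulrA xx mulr1.
    exact: star_wordS_wordS.
  rewrite -[RHS]e1.
  have -> : x * Sw (marker n) = \sum_(c <- l) Sw (c ++ marker n).
    by rewrite xl mulr_suml; apply: eq_bigr => c _; rewrite wordS_cat.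
  rewrite star_sum mulr_suml /m natr_sum !big_seq; apply: eq_bigr => c cl.
  rewrite mulr_sumr natr_sum !big_seq; apply: eq_bigr => d dl.
  by rewrite star_wordS_marker ?ln.
have {}m1 : m = 1%N.
  have : `|(m%:R : R[i]) *: (1 : A)| = m%:R.
    by rewrite normrZ normr_nat norm_one mulr1.
  rewrite scaler_nat m1 norm_one => /esym/eqP.
  by rewrite -[1]/(1%:R) eqr_nat => /eqP.
have lm : (size l <= m)%N.
  rewrite -sum1_size /m !big_seq leq_sum// => c cl.
  by rewrite (big_rem c)//= eqxx leq_addr.
have [w lw] : exists w, l = [:: w].
  move: lm m1; rewrite /m; case: (l) => [|w [|v l'] + m1]; first by rewrite big_nil.
    by exists w.
  by rewrite m1.
by exists w; rewrite xl lw big_seq1.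
Qed.

(** With [n] the length of the longest [b] among the monomials [S_a S_b^*] of
    [u], each [S_b^* S_w] with [|w| = n] is a word or zero, so [u S_w] is a sum
    of words; it is also an isometry. *)
Lemma unitary_normal_form u : unitary_elt u -> monomial_sum u ->
  exists n (g : word -> word), forall w, size w = n -> u * Sw w = Sw (g w).
Proof.
move=> [uu _] [s us]; pose n := (\max_(p <- s) size p.2)%N.
suff /boolp.choice[g hg] : forall w, exists v, size w = n -> u * Sw w = Sw v.
  by exists n, g.
move=> w; have [wn|wn] := eqVneq (size w) n; last first.
  by exists [::] => /eqP; rewrite (negPf wn).
suff [l hl] : exists l : seq word, u * Sw w = \sum_(v <- l) Sw v.
  have [|v hv] := isometric_word_sum hl; last by exists v.
  by rewrite starM mulrA -[_ * star u * u]mulrA uu mulr1 star_wordS_wordS.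
rewrite us mulr_suml.
have sn p : p \in s -> (size p.2 <= n)%N.
  move=> ps.
  by apply: (@leq_bigmax_seq _ s xpredT (fun q : word * word => size q.2)).
clearbody n; elim: s sn {us} => [|p s ih] sn.
  by exists [::]; rewrite !big_nil.
have [|l hl] := ih; first by move=> q qs; rewrite sn// inE qs orbT.
rewrite big_cons hl /monomial -mulrA.
have [/prefixP[v ->]|pw] := boolP (prefix p.2 w).
  by exists ((p.1 ++ v) :: l); rewrite big_cons star_wordS_cat// wordS_cat.
exists l; rewrite star_wordS_incomparable ?mulr0 ?add0r//.
apply: contraNN pw => /prefixP[v e].
have := sn p; rewrite inE eqxx e size_cat wn => /(_ isT).
rewrite -[leqRHS]addn0 leq_add2l leqn0 size_eq0 => /eqP ->.
by rewrite cats0 prefix_refl.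
Qed.

(** * Elements of V and T given by lists *)

Lemma sum_fset_map (F : word -> A) (s : seq (word * word))
    (f : word * word -> word) (J : {fset word}) :
  uniq (map f s) -> (forall a, (a \in J) = (a \in map f s)) ->
  \sum_(a <- J) F a = \sum_(p <- s) F (f p).
Proof.
move=> us mJ; rewrite -[RHS](big_map f xpredT F).
by apply/perm_big/uniq_perm => //; exact: fset_uniq.
Qed.

(** Tables are finite sets without a convenient order, so they are built from
    duplicate-free lists, with orthogonality of the two families of words as the
    hypothesis from which unitarity is computed. *)
Lemma tableV_seq (s : seq (word * word)) : uniq s ->
  {in s &, forall p q, star (Sw p.1) * Sw q.1 = (p == q)%:R} ->
  {in s &, forall p q, star (Sw p.2) * Sw q.2 = (p == q)%:R} ->
  \sum_(p <- s) Pw p.1 = 1 -> \sum_(p <- s) Pw p.2 = 1 ->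
  tableV S [fset p in s]%fset (\sum_(p <- s) monomial p).
Proof.
move=> us o1 o2 s1 s2.
have mem p : (p \in [fset p in s]%fset) = (p \in s) by rewrite in_fset.
have inj (f : word * word -> word) :
    {in s &, forall p q, star (Sw (f p)) * Sw (f q) = (p == q)%:R} ->
    uniq (map f s).
  move=> o; rewrite map_inj_in_uniq// => p q ps qs pq.
  have := o _ _ ps qs; rewrite pq star_wordS_wordS//.
  by case: eqP => // _ /eqP; rewrite oner_eq0.
have memf (f : word * word -> word) a :
    (a \in [fset f p | p in [fset p in s]]%fset) = (a \in map f s).
  apply/imfsetP/mapP => -[p ps ->]; exists p => //; first by rewrite -mem.
  by rewrite inE.
have half (f g : word * word -> word) (x := \sum_(p <- s) Sw (g p) * star (Sw (f p))) :
    {in s &, forall p q, star (Sw (f p)) * Sw (f q) = (p == q)%:R} ->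
    x * star x = \sum_(p <- s) Pw (g p).
  move=> o; rewrite star_sum mulr_suml [LHS]big_seq [RHS]big_seq.
  apply: eq_bigr => p ps.
  rewrite mulr_sumr (bigD1_seq p)//= big_seq_cond big1 ?addr0.
    by rewrite starM starK mulrA -[_ * star _ * _]mulrA o// eqxx mulr1.
  move=> q /andP[qs qp]; rewrite starM starK mulrA -[_ * star _ * _]mulrA o//.
  by rewrite eq_sym (negPf qp) mulr0 mul0r.
split.
- split.
    rewrite -[X in _ * X]starK star_sum.
    under eq_bigr do rewrite starM starK.
    by rewrite (half _ snd).
  by rewrite (half snd fst).
- rewrite /table_elt; apply: perm_big; apply: uniq_perm => //.
  exact: fset_uniq.
- by rewrite (sum_fset_map _ (inj fst o1) (memf fst)).
- by rewrite (sum_fset_map _ (inj snd o2) (memf snd)).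
Qed.

Lemma normal_form_thompsonV u n (g : word -> word) : unitary_elt u ->
  (forall w, size w = n -> u * Sw w = Sw (g w)) -> thompsonV S u.
Proof.
move=> [uu vu] hg; pose s := [seq (g w, w) | w <- words n].
exists [fset p in s]%fset.
have size_s w : w \in words n -> size w = n by rewrite mem_words => /eqP.
have -> : u = \sum_(p <- s) monomial p.
  rewrite big_map -[LHS]mulr1 -(sum_wordP n) mulr_sumr !big_seq.
  by apply: eq_bigr => w /size_s/hg wn; rewrite /monomial /= -wn mulrA.
apply: tableV_seq.
- by rewrite map_inj_uniq ?words_uniq// => a b [].
- move=> _ _ /mapP[a /size_s an ->] /mapP[b /size_s bn ->] /=.
  rewrite -!hg// starM mulrA -[_ * star u * _]mulrA uu mulr1.
  rewrite star_wordS_same_size ?an ?bn//; congr (_%:R); congr nat_of_bool.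
  by apply/eqP/eqP => [->|[]].
- move=> _ _ /mapP[a /size_s an ->] /mapP[b /size_s bn ->] /=.
  rewrite star_wordS_same_size ?an ?bn//; congr (_%:R); congr nat_of_bool.
  by apply/eqP/eqP => [->|[]].
- transitivity (\sum_(w <- words n) u * Pw w * star u).
    rewrite big_map !big_seq; apply: eq_bigr => w /size_s/hg wn /=.
    by rewrite /wordP -wn starM !mulrA.
  by rewrite -mulr_suml -mulr_sumr sum_wordP// mulr1.
- by rewrite big_map sum_wordP.
Qed.

(** The list is already sorted by first components, so it is what sorting the set
    of its entries returns: the order on those entries is antisymmetric because
    the first components are distinct. *)
Lemma lexi_cyclic_seq (s : seq (word * word)) k :
  uniq s -> {in s &, injective fst} -> sorted (fun p q => lexi_le p.1 q.1) s ->
  sorted lexi_le (rot k (map snd s)) -> lexi_cyclic [fset p in s]%fset.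
Proof.
move=> us inj s1 s2; exists k.
suff -> : sort (fun p q => lexi_le p.1 q.1) [fset p in s]%fset = s by [].
have tot : total (fun p q : word * word => lexi_le p.1 q.1).
  by move=> p q; exact: (le_total (p.1 : seqlexi 'I_2)).
have mJ p : (p \in [fset p in s]%fset) = (p \in s) by rewrite in_fset.
apply: sorted_eq_in (sort_sorted tot _) s1 _.
- by move=> p q r _ _ _ /le_trans; apply.
- move=> p q; rewrite !mem_sort !mJ => ps qs pq; apply: inj => //.
  exact: (@le_anti _ (seqlexi 'I_2)).
- by rewrite perm_sort; apply: uniq_perm => //; exact: fset_uniq.
Qed.

(** Boolean, so that it can be decided by computation on explicit lists. *)
Definition prefix_free_by (f : word * word -> word) (s : seq (word * word)) :
    bool :=
  all (fun p => all (fun q => (p == q) || ~~ prefix (f p) (f q)) s) s.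

Lemma prefix_free_star f s : prefix_free_by f s ->
  {in s &, forall p q, star (Sw (f p)) * Sw (f q) = (p == q)%:R}.
Proof.
move=> /allP pf p q ps qs; have [->|pq] := eqVneq p q.
  exact: star_wordS_wordS.
have no p' q' : p' \in s -> q' \in s -> p' != q' -> ~~ prefix (f p') (f q').
  by move=> /pf/allP h /h /orP[/eqP->|//]; rewrite eqxx.
by rewrite star_wordS_incomparable// no// eq_sym.
Qed.

Lemma thompsonT_seq (s : seq (word * word)) k :
  uniq s -> prefix_free_by fst s -> prefix_free_by snd s ->
  \sum_(p <- s) Pw p.1 = 1 -> \sum_(p <- s) Pw p.2 = 1 ->
  sorted (fun p q => lexi_le p.1 q.1) s ->
  sorted lexi_le (rot k (map snd s)) ->
  thompsonT S (\sum_(p <- s) monomial p).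
Proof.
move=> us p1 p2 s1 s2 l1 l2; exists [fset p in s]%fset.
  by apply: tableV_seq => //; exact: prefix_free_star.
apply: lexi_cyclic_seq l1 l2 => // p q ps qs /= pq.
have := prefix_free_star p1 ps qs; rewrite pq star_wordS_wordS//.
by case: eqP => // _ /eqP; rewrite oner_eq0.
Qed.

(** Multiplying by [P_b] selects the row [(a, b)] of the table. *)
Lemma table_cut (s : seq (word * word)) p : uniq s -> prefix_free_by snd s ->
  p \in s -> (\sum_(q <- s) monomial q) * Pw p.2 = monomial p.
Proof.
move=> us p2 ps; rewrite (bigD1_seq p)//= mulrDl mulr_suml.
rewrite big_seq_cond big1 ?addr0.
  by rewrite /monomial -mulrA [_ * Pw _]mulrA star_wordS_wordS// mul1r.
move=> q /andP[qs qp]; rewrite /monomial -mulrA [_ * Pw _]mulrA.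
by rewrite (prefix_free_star p2)// (negPf qp) mul0r mulr0.
Qed.

(** * Four elements of T *)

Let i0 : 'I_2 := ord0.
Let i1 : 'I_2 := ord_max.
(** The two partitions of the Cantor set into three cylinders. *)
Let left_comb : seq word := [:: [:: i0; i0]; [:: i0; i1]; [:: i1]].
Let right_comb : seq word := [:: [:: i0]; [:: i1; i0]; [:: i1; i1]].

Lemma wordP_branch w : Pw w = Pw (rcons w i0) + Pw (rcons w i1).
Proof.
rewrite (wordP_split 1 w) big_allpairs_dep big_enum /=.
rewrite big_ord_recl big_ord1 !big_seq1 !cats1 /i0.
by congr (_ + Pw (rcons _ _)); apply: val_inj.
Qed.

Lemma sum_root : Pw [:: i0] + Pw [:: i1] = 1.
Proof. by rewrite -(wordP_branch [::]) /wordP wordS0 star1 mulr1. Qed.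

Lemma sum_left_comb : \sum_(w <- left_comb) Pw w = 1.
Proof.
by rewrite !big_cons big_nil addr0 addrA -(wordP_branch [:: i0]) sum_root.
Qed.

Lemma sum_right_comb : \sum_(w <- right_comb) Pw w = 1.
Proof.
by rewrite !big_cons big_nil addr0 -(wordP_branch [:: i1]) sum_root.
Qed.

Lemma letterP i : i = i0 \/ i = i1.
Proof. by case: i => [[|[|//]] ?]; [left|right]; apply: val_inj. Qed.

(** Rotating the second column of a table with sorted columns gives an element of
    [T]. The remaining requirements are decidable, hence gathered in one boolean
    that explicit lists satisfy by computation. *)
Lemma thompsonT_zip (F G : seq word) m i j : size F = size G ->
  \sum_(w <- F) Pw w = 1 -> \sum_(w <- G) Pw w = 1 ->
  let s := zip F (rot m G) in
  [&& uniq s, prefix_free_by fst s, prefix_free_by snd s,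
      sorted lexi_le F, sorted lexi_le G & ([:: i; j], [:: j]) \in s] ->
  exists2 v, thompsonT S v & v * Pw [:: j] = monomial ([:: i; j], [:: j]).
Proof.
move=> FG sF sG s /and5P[us p1 p2 lF /andP[lG ij]].
have s1 : map fst s = F by rewrite -/unzip1 unzip1_zip// size_rot FG.
have s2 : map snd s = rot m G by rewrite -/unzip2 unzip2_zip// size_rot FG.
exists (\sum_(p <- s) monomial p); last exact: (table_cut us p2 ij).
apply: (thompsonT_seq (k := (size G - m)%N)) => //.
- by rewrite -[LHS](big_map fst xpredT) s1.
- rewrite -[LHS](big_map snd xpredT) s2 -[RHS]sG; apply: perm_big.
  by rewrite perm_rot.
- by move: lF; rewrite -s1 sorted_map.
- by rewrite s2 -[X in rot (X - _)](size_rot m) -/(rotr m _) rotK.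
Qed.

(** The word [ij] occurs in [left_comb] for [i = 0] and in [right_comb] for
    [i = 1]; the word [j] occurs in [right_comb] for [j = 0] and in [left_comb]
    for [j = 1]. The rotation is the one that puts [j] next to [ij]. *)
Lemma thompsonT_cut i j : exists2 v, thompsonT S v &
  v * Pw [:: j] = monomial ([:: i; j], [:: j]).
Proof.
have [->|->] := letterP i; have [->|->] := letterP j.
- exact: (thompsonT_zip (m := 0) _ sum_left_comb sum_right_comb).
- exact: (thompsonT_zip (m := 1) _ sum_left_comb sum_left_comb).
- exact: (thompsonT_zip (m := 2) _ sum_right_comb sum_right_comb).
- exact: (thompsonT_zip (m := 0) _ sum_right_comb sum_left_comb).
Qed.

(** * Projections of the diagonal *)

Definition scalar_at x n := forall w, size w = n -> exists c : R[i],
  x * Sw w = c *: Sw w /\ star (Sw w) * x = c *: star (Sw w).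

Lemma scalar_at_le x n m : (n <= m)%N -> scalar_at x n -> scalar_at x m.
Proof.
move=> nm hx w wm; have [|c [cl cr]] := hx (take n w).
  by rewrite size_takel ?wm.
exists c; rewrite -{1 2 3 4}(cat_take_drop n w) wordS_cat starM.
by rewrite mulrA cl scalerAl -mulrA cr scalerAr.
Qed.

(** The linear span of the [P_w]: an element is a combination of the [P_w] with
    [|w| = n] exactly when it acts as a scalar on each of the corresponding
    [S_w], a condition that the algebra operations visibly preserve. *)
Definition step_diagonal : set A := [set x | exists n, scalar_at x n].

Lemma step_diagonal_star : star_subalgebra step_diagonal.
Proof.
split.
- by exists 0%N => w _; exists 0; rewrite !scale0r mul0r mulr0.
- move=> k x y [n /(scalar_at_le (leq_maxl n _)) hx].
  move=> [m /(scalar_at_le (leq_maxr _ m)) hy].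
  exists (maxn n m) => w wn.
  have [c [cl cr]] := hx m w wn; have [d [dl dr]] := hy n w wn.
  exists (k * c + d); rewrite mulrDl mulrDr -scalerAl -scalerAr cl cr dl dr.
  by rewrite !scalerA -!scalerDl.
- move=> x y [n /(scalar_at_le (leq_maxl n _)) hx].
  move=> [m /(scalar_at_le (leq_maxr _ m)) hy].
  exists (maxn n m) => w wn.
  have [c [cl cr]] := hx m w wn; have [d [dl dr]] := hy n w wn.
  exists (d * c); rewrite -mulrA dl -scalerAr cl scalerA mulrA cr -scalerAl dr.
  by rewrite scalerA mulrC.
- move=> x [n hx]; exists n => w /hx[c [cl cr]]; exists c^*; split.
    by rewrite -[Sw w]starK -starM cr starZ.
  by rewrite -starM cl starZ.
Qed.

Lemma step_diagonal_wordP w : step_diagonal (Pw w).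
Proof.
exists (size w) => v vw; exists (w == v)%:R.
have e : Pw w * Sw v = (w == v)%:R *: Sw v.
  rewrite /wordP -mulrA star_wordS_same_size//.
  by have [->|] := eqVneq w v; rewrite ?mulr1 ?scale1r ?mulr0 ?scale0r.
by split=> //; rewrite -star_wordP -starM e starZ conjC_nat.
Qed.

Lemma diagonal_sub : cuntz_diagonal S `<=` approximable step_diagonal.
Proof.
move=> x; apply; split; first exact/approximable_cstar/step_diagonal_star.
by move=> _ [w _ <-]; exact/sub_approximable/step_diagonal_wordP.
Qed.

Lemma step_diagonal_comm x w : step_diagonal x -> x * Pw w = Pw w * x.
Proof.
move=> [n hx]; apply: (eq_on_words (n := n)) => v /hx[c [hc _]].
have -> : x * Pw w * Sw v = x * Pw v * Pw w * Sw v.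
  rewrite -[x * Pw v * _]mulrA [Pw v * _]wordP_comm// mulrA -[RHS]mulrA.
  by rewrite wordP_wordS.
have -> : x * Pw v = c *: Pw v by rewrite /wordP mulrA hc scalerAl.
rewrite -!scalerAl wordP_comm// -[in LHS]mulrA wordP_wordS//.
by rewrite -mulrA hc -scalerAr.
Qed.

(** Approximate [p] within 1/2 by some [y] that acts as a scalar on every [S_w],
    [|w| = n]. As [p] commutes with [P_w], the compression [S_w^* p S_w] is a
    projection; it is close to a scalar, so it is 0 or 1. Hence [p P_w] is 0 or
    [P_w], and [p] is the sum of those [P_w] for which the latter holds. *)
Lemma diagonal_projection p : approximable step_diagonal p ->
  star p = p -> p * p = p -> monomial_sum p.
Proof.
move=> hp sp pp.
have comm w : p * Pw w = Pw w * p.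
  apply/subr0_eq/(@norm_small_eq0 _ _ (`|Pw w| + `|Pw w|)) => [|e /hp[y hy py]].
    exact: addr_ge0.
  have -> : p * Pw w - Pw w * p = (p - y) * Pw w - Pw w * (p - y).
    by rewrite mulrBl mulrBr (step_diagonal_comm w hy) opprB addrA addrNK.
  rewrite (le_trans (ler_normB _ _))//.
  rewrite (le_trans (lerD (norm_mul_le _ _) (norm_mul_le _ _)))//.
  by rewrite [X in X + _]mulrC -mulrDl ler_wpM2l ?addr_ge0// ltW.
have half_gt0 : 0 < (2^-1 : R[i]) by rewrite invr_gt0.
have [y [n hy] py] := hp _ half_gt0.
rewrite -[p]mulr1 -(sum_wordP n) mulr_sumr big_seq.
apply: monomial_sum_sum => w; rewrite mem_words => /eqP wn.
pose q := star (Sw w) * p * Sw w.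
have pq : p * Sw w = Sw w * q.
  rewrite /q !mulrA -/(Pw w) -comm -mulrA wordP_wordS//.
have [c [hc _]] := hy w wn.
have [|||q0|q1] := @projection_near_scalar _ _ q c.
- by rewrite /q !starM starK sp mulrA.
- by rewrite {1}/q -mulrA -pq mulrA -[_ * p * p]mulrA pp.
- have -> : q - c *: 1 = star (Sw w) * (p - y) * Sw w.
    rewrite mulrBr mulrBl -/q -[_ * y * _]mulrA hc -scalerAr star_wordS_wordS//.
  have nS : `|Sw w| = 1 by exact/norm_isometry/star_wordS_wordS.
  rewrite (le_lt_trans (norm_mul_le _ _))// nS mulr1.
  by rewrite (le_lt_trans (norm_mul_le _ _))// norm_star nS mul1r.
- by rewrite /wordP mulrA pq q0 mulr0 mul0r; exact: monomial_sum0.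
- rewrite /wordP mulrA pq q1 mulr1; exact: (monomial_sum_monomial (_, _)).
Qed.

(** * The endomorphism and the diagonal *)

Definition projection_sum : set A :=
  [set x | exists l : seq word, x = \sum_(w <- l) Pw w].

Lemma projection_sum_sum (I : Type) (r : seq I) (P : pred I) (F : I -> A) :
  (forall i, P i -> projection_sum (F i)) ->
  projection_sum (\sum_(i <- r | P i) F i).
Proof.
move=> hF; apply: big_ind => //; first by exists [::]; rewrite big_nil.
by move=> _ _ [l ->] [m ->]; exists (l ++ m); rewrite big_cat.
Qed.

Lemma projection_sum_diagonal x : projection_sum x -> cuntz_diagonal S x.
Proof.
move=> [l ->] B [[B0 BL _ _ _] PB].
apply: big_ind => // [y z By Bz|w _]; last by apply: PB; exists w.
by rewrite -[y]scale1r; exact: BL.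
Qed.

Lemma thompsonV_monomial_sum u : thompsonV S u -> monomial_sum u.
Proof. by move=> [J [_ -> _ _]]; exists J. Qed.

(** Splitting [P_w] into the [P_(wv)] with [|v| = n] makes every word at least as
    long as those on which [u] acts by substitution of a prefix. *)
Lemma normal_form_projection_sum u n (g : word -> word) w :
  (forall v, size v = n -> u * Sw v = Sw (g v)) ->
  projection_sum (u * Pw w * star u).
Proof.
move=> hg; rewrite (wordP_split n) mulr_sumr mulr_suml big_seq.
apply: projection_sum_sum => v; rewrite mem_words => /eqP vn.
set t := w ++ v; have nt : (n <= size t)%N by rewrite size_cat vn leq_addl.
exists [:: g (take n t) ++ drop n t]; rewrite big_seq1.
rewrite -{1}(cat_take_drop n t) /wordP !wordS_cat -hg ?size_takel//.
by rewrite !starM !mulrA.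
Qed.

Section Endomorphism.
Variables (u : A) (lam : {lrmorphism A -> A}).
Hypotheses (u_unitary : unitary_elt u) (hlam : cuntz_endo S u lam).

Lemma thompsonV_diagonal :
  thompsonV S u -> lam @` cuntz_diagonal S `<=` cuntz_diagonal S.
Proof.
case: hlam => lam_star lamS /thompsonV_monomial_sum.
move=> /(unitary_normal_form u_unitary)[n [g hg]].
have lamP w : projection_sum (lam (Pw w)).
  elim: w => [|i w [l hl]].
    exists [:: [::]]; rewrite big_seq1 /wordP wordS0 star1 mulr1 rmorph1//.
  have -> : Pw (i :: w) = S i * Pw w * star (S i).
    by rewrite /wordP wordS_cons starM !mulrA.
  rewrite rmorphM /= rmorphM /= lam_star lamS hl starM mulr_sumr mulr_suml.
  apply: projection_sum_sum => v _.
  have -> : u * S i * Pw v * (star (S i) * star u) = u * Pw (i :: v) * star u.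
    by rewrite /wordP wordS_cons starM !mulrA.
  exact: normal_form_projection_sum hg.
move=> _ [x Dx <-] B [cB PB].
apply: (Dx (lam @^-1` B)); split; first exact: preimage_cstar_subalgebra.
move=> _ [w _ <-]; apply: (projection_sum_diagonal (lamP w)).
by split.
Qed.

Lemma diagonal_thompsonV :
  lam @` thompsonT S `<=` thompsonV S ->
  lam @` cuntz_diagonal S `<=` cuntz_diagonal S -> thompsonV S u.
Proof.
case: hlam => lam_star lamS lamT lamD.
have lam_cut i j : monomial_sum (lam (monomial ([:: i; j], [:: j]))).
  have [v Tv <-] := thompsonT_cut i j.
  rewrite rmorphM; apply: monomial_sumM => //.
    by apply: thompsonV_monomial_sum; apply: lamT; exists v.
  apply: diagonal_projection.
  - apply: diagonal_sub => //; apply: lamD; exists (Pw [:: j]) => //.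
    by move=> B [_]; apply; exists [:: j].
  - by rewrite -lam_star star_wordP.
  - by rewrite -rmorphM {2}/wordP mulrA wordP_wordS.
have : monomial_sum u.
  have -> : u = \sum_i \sum_j
      lam (monomial ([:: i; j], [:: j])) * monomial ([::], [:: i]).
    have lamP : \sum_j lam (S j * star (S j)) = 1.
      by rewrite -rmorph_sum S_total rmorph1.
    rewrite -[LHS]mulr1 -{1}S_total mulr_sumr; apply: eq_bigr => i _.
    rewrite -mulr_suml.
    have -> : \sum_j lam (monomial ([:: i; j], [:: j])) = u * S i.
      rewrite -[RHS]mulr1 -lamP mulr_sumr; apply: eq_bigr => j _.
      by rewrite /monomial /= !wordS_cons !wordS0 !mulr1 -lamS -rmorphM !mulrA.
    by rewrite /monomial /= wordS_cons wordS0 mulr1 mul1r !mulrA.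
  apply: monomial_sum_sum => i _; apply: monomial_sum_sum => j _.
  by apply: monomial_sumM => //; exact: monomial_sum_monomial.
move=> /(unitary_normal_form u_unitary)[n [g hg]].
exact: normal_form_thompsonV hg.
Qed.

End Endomorphism.

End Cuntz.

Theorem proposition3p20 (R : realType) (A : cstarAlgType R) (S : 'I_2 -> A)
    (hS : cuntz_algebra S) (u : A) (hu : unitary_elt u)
    (lam : {lrmorphism A -> A}) (hlam : cuntz_endo S u lam)
    (hTV : lam @` thompsonT S `<=` thompsonV S) :
  thompsonV S u <-> lam @` cuntz_diagonal S `<=` cuntz_diagonal S.
Proof.
have [S_isometry S_total _] := hS; split.
- exact: thompsonV_diagonal.
- exact: diagonal_thompsonV.
Qed.
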